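(* Let $\mathcal{C}$ be a homological category and let $(\mathbf{R},\mu)$ be a radical on $\mathcal{C}$, with associated reflective subcategory $\mathcal{X}$ of objects $X$ with $\mathbf{R}(X)=0$, reflector $\mathbf{I}$ and unit $\eta$. The class $\mathbf{I}^{-1}(RegEpi\;\mathcal{X})$ is that of morphisms $f:C\to C'$ of $\mathcal{C}$ such that the composition $\eta_{C'}f$ is a regular epimorphism. If the image of $f:C\to C'$ is a normal monomorphism, then $f\in\mathbf{I}^{-1}(RegEpi\;\mathcal{X})$ if and only if $Im\,f+\mathbf{R}(C')=C'$. In particular, the latter criterion holds for any morphism $f$ if $\mathcal{C}$ is abelian.
   Context: A category is homological if it is pointed, regular and protomodular. A normal monomorphism is a monomorphism that is a kernel; in a homological category every normal monomorphism $C\rightarrowtail C'$ has a cokernel, whose codomain is denoted $C'/C$. A radical on a homological category $\mathcal{C}$ is a pair $(\mathbf{R},\mu)$, where $\mathbf{R}$ is an endofunctor of $\mathcal{C}$ and $\mu:\mathbf{R}\to 1_{\mathcal{C}}$ is a natural transformation such that, for every object $C$, $\mu_C:\mathbf{R}(C)\to C$ is a normal monomorphism and $\mathbf{R}(C/\mathbf{R}(C))=0$. The full subcategory $\mathcal{X}$ of objects $X$ with $\mathbf{R}(X)=0$ is reflective in $\mathcal{C}$; the reflector is $\mathbf{I}(C)=C/\mathbf{R}(C)$ and the unit $\eta_C:C\to C/\mathbf{R}(C)$ is the cokernel of $\mu_C$. $RegEpi\;\mathcal{X}$ denotes the class of regular epimorphisms of $\mathcal{X}$, and $\mathbf{I}^{-1}(RegEpi\;\mathcal{X})$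 is the class of morphisms $f$ of $\mathcal{C}$ with $\mathbf{I}(f)\in RegEpi\;\mathcal{X}$. The image $Im\,f$ of $f$ is the subobject given by the monomorphism in the (regular epimorphism, monomorphism)-factorization of $f$ in $\mathcal{C}$. For normal subobjects $H,K$ of an object $C'$, $H+K$ denotes their supremum in the partially ordered class of subobjects of $C'$ (it exists in any homological category). *)

(* Defs.v *)
Set Implicit Arguments.
Unset Strict Implicit.
Unset Printing Implicit Defensive.

Declare Scope cat_scope.
Delimit Scope cat_scope with cat.
Local Open Scope cat_scope.

(** * Categories, functors, natural transformations *)

(* Morphisms are compared by Leibniz equality. *)
Record category := Category {
  Ob :> Type;
  Hom : Ob -> Ob -> Type;
  idm : forall a : Ob, Hom a a;
  comp : forall a b c : Ob, Hom b c -> Hom a b -> Hom a c;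
  comp_idl : forall (a b : Ob) (f : Hom a b), comp (idm b) f = f;
  comp_idr : forall (a b : Ob) (f : Hom a b), comp f (idm a) = f;
  comp_assoc : forall (a b c d : Ob)
    (h : Hom c d) (g : Hom b c) (f : Hom a b),
    comp h (comp g f) = comp (comp h g) f
}.
Arguments Hom {c} a b : rename.
Arguments idm {c} a : rename.
Arguments comp {c} {a b c0} g f : rename.

Notation "g ∘ f" := (comp g f) (at level 40, left associativity) : cat_scope.

Record functor (C D : category) := Functor {
  fob :> C -> D;
  fmap : forall a b : C, Hom a b -> Hom (fob a) (fob b);
  fmap_id : forall a : C, fmap (idm a) = idm (fob a);
  fmap_comp : forall (a b c : C) (g : Hom b c) (f : Hom a b),
    fmap (g ∘ f) = fmap g ∘ fmap f
}.
Arguments fmap {C D} F {a b} f : rename.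

Definition id_functor (C : category) : functor C C :=
  @Functor C C (fun a => a) (fun _ _ f => f)
    (fun _ => eq_refl) (fun _ _ _ _ _ => eq_refl).

Definition comp_functor (C D E : category)
    (G : functor D E) (F : functor C D) : functor C E.
Proof.
refine (@Functor C E (fun a => G (F a)) (fun a b f => fmap G (fmap F f)) _ _).
- intros a; now rewrite !fmap_id.
- intros a b c g f; now rewrite !fmap_comp.
Defined.

Record nat_trans (C D : category) (F G : functor C D) := NatTrans {
  component :> forall a : C, Hom (F a) (G a);
  naturality : forall (a b : C) (f : Hom a b),
    component b ∘ fmap F f = fmap G f ∘ component a
}.

Definition full_subcategory (C : category) (P : C -> Prop) : category :=
  @Category {a : C | P a}
    (fun a b => @Hom C (proj1_sig a) (proj1_sig b))
    (fun a => idm (proj1_sig a))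
    (fun a b c g f => g ∘ f)
    (fun a b f => comp_idl f)
    (fun a b f => comp_idr f)
    (fun a b c d h g f => comp_assoc h g f).

Definition inclusion (C : category) (P : C -> Prop) :
    functor (full_subcategory P) C :=
  @Functor (full_subcategory P) C (fun a => proj1_sig a) (fun _ _ f => f)
    (fun _ => eq_refl) (fun _ _ _ _ _ => eq_refl).

(** * Classes of morphisms *)

Definition morphism_class (C : category) :=
  forall a b : C, Hom a b -> Prop.

Definition inverse_image_class (C D : category) (F : functor C D)
    (E : morphism_class D) : morphism_class C :=
  fun a b f => E (F a) (F b) (fmap F f).

Definition is_iso (C : category) (a b : C) (f : Hom a b) : Prop :=
  exists g : Hom b a, g ∘ f = idm a /\ f ∘ g = idm b.

Definition is_mono (C : category) (a b : C) (m : Hom a b) : Prop :=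
  forall (x : C) (u v : Hom x a), m ∘ u = m ∘ v -> u = v.

Definition is_epi (C : category) (a b : C) (e : Hom a b) : Prop :=
  forall (x : C) (u v : Hom b x), u ∘ e = v ∘ e -> u = v.

Definition is_coequalizer (C : category) (k a q : C)
    (u v : Hom k a) (e : Hom a q) : Prop :=
  e ∘ u = e ∘ v /\
  forall (x : C) (h : Hom a x), h ∘ u = h ∘ v ->
    exists! h' : Hom q x, h' ∘ e = h.

Definition RegEpi (C : category) : morphism_class C :=
  fun a b e => exists (k : C) (u v : Hom k a), is_coequalizer u v e.

(** * Limits and colimits *)

Definition is_terminal (C : category) (t : C) : Prop :=
  forall a : C, exists! f : Hom a t, True.

Definition is_initial (C : category) (i : C) : Prop :=
  forall a : C, exists! f : Hom i a, True.

Definition is_product (C : category) (a b p : C)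
    (p1 : Hom p a) (p2 : Hom p b) : Prop :=
  forall (x : C) (u : Hom x a) (v : Hom x b),
    exists! h : Hom x p, p1 ∘ h = u /\ p2 ∘ h = v.

Definition is_coproduct (C : category) (a b s : C)
    (i1 : Hom a s) (i2 : Hom b s) : Prop :=
  forall (x : C) (u : Hom a x) (v : Hom b x),
    exists! h : Hom s x, h ∘ i1 = u /\ h ∘ i2 = v.

Definition is_pullback (C : category) (a b c p : C)
    (f : Hom a c) (g : Hom b c) (p1 : Hom p a) (p2 : Hom p b) : Prop :=
  f ∘ p1 = g ∘ p2 /\
  forall (x : C) (u : Hom x a) (v : Hom x b), f ∘ u = g ∘ v ->
    exists! h : Hom x p, p1 ∘ h = u /\ p2 ∘ h = v.

Definition is_kernel_pair (C : category) (a b k : C)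
    (f : Hom a b) (p1 p2 : Hom k a) : Prop :=
  is_pullback f f p1 p2.

Definition finitely_complete (C : category) : Prop :=
  (exists t : C, is_terminal t) /\
  (forall (a b c : C) (f : Hom a c) (g : Hom b c),
    exists (p : C) (p1 : Hom p a) (p2 : Hom p b), is_pullback f g p1 p2).

(** * Zero morphisms, kernels, cokernels *)

Definition is_zero_object (C : category) (z : C) : Prop :=
  is_initial z /\ is_terminal z.

Definition is_zero_morphism (C : category) (a b : C) (f : Hom a b) : Prop :=
  exists (z : C) (u : Hom a z) (v : Hom z b), is_zero_object z /\ f = v ∘ u.

Definition is_kernel (C : category) (a b k : C)
    (f : Hom a b) (i : Hom k a) : Prop :=
  is_zero_morphism (f ∘ i) /\
  forall (x : C) (h : Hom x a), is_zero_morphism (f ∘ h) ->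
    exists! h' : Hom x k, i ∘ h' = h.

Definition is_cokernel (C : category) (a b q : C)
    (f : Hom a b) (p : Hom b q) : Prop :=
  is_zero_morphism (p ∘ f) /\
  forall (x : C) (h : Hom b x), is_zero_morphism (h ∘ f) ->
    exists! h' : Hom q x, h' ∘ p = h.

Definition is_normal_mono (C : category) (a b : C) (m : Hom a b) : Prop :=
  is_mono m /\ exists (d : C) (f : Hom b d), is_kernel f m.

Definition is_normal_epi (C : category) (a b : C) (e : Hom a b) : Prop :=
  is_epi e /\ exists (d : C) (f : Hom d a), is_cokernel f e.

(** * Homological and abelian categories *)

Definition pointed (C : category) : Prop := exists z : C, is_zero_object z.

Definition regular (C : category) : Prop :=
  finitely_complete C /\
  (forall (a b k : C) (f : Hom a b) (p1 p2 : Hom k a),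
    is_kernel_pair f p1 p2 ->
    exists (q : C) (e : Hom a q), is_coequalizer p1 p2 e) /\
  (forall (a b c p : C) (f : Hom a c) (g : Hom b c)
    (p1 : Hom p a) (p2 : Hom p b),
    is_pullback f g p1 p2 -> RegEpi f -> RegEpi p2).

(* A point over [i] is a split epimorphism [p] onto [i] with a chosen section
   [s]; morphisms of points over [i] commute with both. *)
Definition is_point (C : category) (a i : C)
    (p : Hom a i) (s : Hom i a) : Prop :=
  p ∘ s = idm i.

(* For every [v : j -> i], the change-of-base functor from points over [i] to
   points over [j] reflects isomorphisms. Here [phi'] is the image of [phi]
   under this functor: it is the map between the pullbacks of [p] and [q]
   along [v] induced by [phi]. *)
Definition protomodular (C : category) : Prop :=
  finitely_complete C /\
  forall (i j : C) (v : Hom j i)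
    (a : C) (p : Hom a i) (s : Hom i a)
    (b : C) (q : Hom b i) (t : Hom i b) (phi : Hom a b)
    (a' : C) (va : Hom a' a) (p' : Hom a' j)
    (b' : C) (vb : Hom b' b) (q' : Hom b' j) (phi' : Hom a' b'),
    is_point p s -> is_point q t ->
    q ∘ phi = p -> phi ∘ s = t ->
    is_pullback p v va p' -> is_pullback q v vb q' ->
    vb ∘ phi' = phi ∘ va -> q' ∘ phi' = p' ->
    is_iso phi' -> is_iso phi.

Definition homological (C : category) : Prop :=
  pointed C /\ regular C /\ protomodular C.

Definition abelian (C : category) : Prop :=
  pointed C /\
  (forall a b : C,
    exists (p : C) (p1 : Hom p a) (p2 : Hom p b), is_product p1 p2) /\
  (forall a b : C,
    exists (s : C) (i1 : Hom a s) (i2 : Hom b s), is_coproduct i1 i2) /\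
  (forall (a b : C) (f : Hom a b), exists (k : C) (i : Hom k a), is_kernel f i) /\
  (forall (a b : C) (f : Hom a b), exists (q : C) (p : Hom b q), is_cokernel f p) /\
  (forall (a b : C) (m : Hom a b), is_mono m -> is_normal_mono m) /\
  (forall (a b : C) (e : Hom a b), is_epi e -> is_normal_epi e).

(** * Subobjects *)

(* Subobjects of [c] are represented by monomorphisms into [c]; two of them are
   the same subobject when each is [sub_le] the other. *)
Definition sub_le (C : category) (a b c : C)
    (m : Hom a c) (n : Hom b c) : Prop :=
  exists h : Hom a b, n ∘ h = m.

Definition is_sup (C : category) (h k s c : C)
    (mh : Hom h c) (mk : Hom k c) (ms : Hom s c) : Prop :=
  is_mono ms /\ sub_le mh ms /\ sub_le mk ms /\
  forall (t : C) (mt : Hom t c), is_mono mt ->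
    sub_le mh mt -> sub_le mk mt -> sub_le ms mt.

Definition is_image (C : category) (a b i : C)
    (f : Hom a b) (m : Hom i b) : Prop :=
  is_mono m /\ exists e : Hom a i, RegEpi e /\ f = m ∘ e.

(* H + K = c, i.e. the largest subobject [idm c] is the supremum of H and K. *)
Definition sup_is_whole (C : category) (h k c : C)
    (mh : Hom h c) (mk : Hom k c) : Prop :=
  is_sup mh mk (idm c).

(** * Radicals *)

(* The quotient C/R(C) is any codomain of a cokernel of [mu C]. *)
Record radical (C : category) := Radical {
  rad :> functor C C;
  mu : nat_trans rad (id_functor C);
  mu_normal : forall c : C, is_normal_mono (mu c);
  rad_quotient : forall (c q : C) (p : Hom c q),
    is_cokernel (mu c) p -> is_zero_object (rad q)
}.

Definition radical_free (C : category) (R : radical C) : category :=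
  full_subcategory (fun x : C => is_zero_object (R x)).

(* A choice of the reflector C |-> C/R(C), with its unit: the cokernels [eta]
   of the [mu C] are part of the data, and the action of [reflector] on
   morphisms is determined by naturality of [eta]. *)
Record radical_reflection (C : category) (R : radical C) := RadicalReflection {
  reflector :> functor C (radical_free R);
  eta : nat_trans (id_functor C) (comp_functor (inclusion _) reflector);
  eta_cokernel : forall c : C, is_cokernel (mu R c) (eta c)
}.
Arguments eta {C R} I : rename.

(* Main.v *)
(** In a regular category the regular epimorphisms are the extremal ones: those
    that factor through no monomorphism other than the isomorphisms.
    Objects with zero radical are closed under subobjects and kernel pairs, so a
    morphism between them is a regular epimorphism of X exactly when it is one
    in C; as eta is a regular epimorphism, I(f) is one iff I(f) eta = eta f is.
    For a subobject m of C', write q = eta_C'.  If q m is extremal and the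
    subobject t contains both m and R(C') = Ker q, then q t is a regular
    epimorphism with the same kernel as q, and protomodularity (in the form of
    the short five lemma) makes t invertible.  Conversely, if q m factors through
    a mono n, the pullback of n along q contains both m and R(C'); if it must be
    the whole of C', then n is invertible. *)

From Stdlib Require Import Setoid.
Require Import Defs.

Set Implicit Arguments.
Unset Strict Implicit.
Unset Printing Implicit Defensive.

Local Open Scope cat_scope.

(* A mono with a section is an isomorphism, and the section is what is used. *)
Definition extremal_epi (C : category) (a b : C) (f : Hom a b) : Prop :=
  forall (s : C) (m : Hom s b) (h : Hom a s),
    is_mono m -> m ∘ h = f -> exists r : Hom b s, m ∘ r = idm b.

(** * Pullbacks, regular and extremal epimorphisms *)

Section Universal.
Variable C : category.

Lemma initial_eq (z a : C) (u v : Hom z a) : is_initial z -> u = v.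
Proof.
intros hz; destruct (hz a) as [w [_ hw]].
now rewrite <- (hw u I), <- (hw v I).
Qed.

Lemma terminal_eq (z a : C) (u v : Hom a z) : is_terminal z -> u = v.
Proof.
intros hz; destruct (hz a) as [w [_ hw]].
now rewrite <- (hw u I), <- (hw v I).
Qed.

Lemma pullback_eq (a b c p x : C) (f : Hom a c) (g : Hom b c)
    (p1 : Hom p a) (p2 : Hom p b) (u v : Hom x p) :
  is_pullback f g p1 p2 -> p1 ∘ u = p1 ∘ v -> p2 ∘ u = p2 ∘ v -> u = v.
Proof.
intros [hc hu] h1 h2.
destruct (hu x (p1 ∘ u) (p2 ∘ u)) as [w [_ hw]].
{ now rewrite !comp_assoc, hc. }
now rewrite <- (hw u), <- (hw v).
Qed.

Lemma pullback_mono (a b c p : C) (f : Hom a c) (g : Hom b c)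
    (p1 : Hom p a) (p2 : Hom p b) :
  is_pullback f g p1 p2 -> is_mono g -> is_mono p1.
Proof.
intros hp hg x u v huv.
apply (pullback_eq hp huv), hg.
destruct hp as [hc _].
now rewrite !comp_assoc, <- hc, <- !comp_assoc, huv.
Qed.

Lemma pullback_sym (a b c p : C) (f : Hom a c) (g : Hom b c)
    (p1 : Hom p a) (p2 : Hom p b) :
  is_pullback f g p1 p2 -> is_pullback g f p2 p1.
Proof.
intros [hc hu]; split; [now symmetry|].
intros x u v h; destruct (hu x v u) as [w [[h1 h2] hw]]; [now symmetry|].
exists w; split; [now split|].
intros w' [h1' h2']; now apply hw.
Qed.

Lemma RegEpi_epi (a b : C) (e : Hom a b) : RegEpi e -> is_epi e.
Proof.
intros [k [u [v [hc hu]]]] x r s hrs.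
destruct (hu x (r ∘ e)) as [w [_ hw]].
{ now rewrite <- !comp_assoc, hc. }
now rewrite <- (hw r), <- (hw s).
Qed.

Lemma RegEpi_extremal (a b : C) (f : Hom a b) : RegEpi f -> extremal_epi f.
Proof.
intros hf s m h hm hmh.
pose proof (RegEpi_epi hf) as ef.
destruct hf as [k [u [v [hc hu]]]].
destruct (hu s h) as [r [hr _]].
{ apply hm; now rewrite !comp_assoc, hmh. }
exists r; apply ef.
now rewrite comp_idl, <- comp_assoc, hr.
Qed.

Lemma RegEpi_iso_comp (a q b : C) (e : Hom a q) (m : Hom q b) (r : Hom b q) :
  RegEpi e -> r ∘ m = idm q -> m ∘ r = idm b -> RegEpi (m ∘ e).
Proof.
intros [k [u [v [hc hu]]]] hrm hmr.
exists k, u, v; split.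
- now rewrite <- !comp_assoc, hc.
- intros x h hh; destruct (hu x h hh) as [w [hw uw]].
  exists (w ∘ r); split.
  + now rewrite <- comp_assoc, (comp_assoc r), hrm, comp_idl.
  + intros w' hw'.
    rewrite (uw (w' ∘ m)).
    * now rewrite <- comp_assoc, hmr, comp_idr.
    * now rewrite <- comp_assoc.
Qed.

Lemma mono_retraction (s b : C) (m : Hom s b) (r : Hom b s) :
  is_mono m -> m ∘ r = idm b -> r ∘ m = idm s.
Proof.
intros hm h; apply hm.
now rewrite comp_assoc, h, comp_idl, comp_idr.
Qed.

Lemma extremal_epi_left (a b c : C) (g : Hom b c) (f : Hom a b) :
  extremal_epi (g ∘ f) -> extremal_epi g.
Proof.
intros h s m k hm hk; apply (h s m (k ∘ f) hm).
now rewrite comp_assoc, hk.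
Qed.

End Universal.

(** * Zero morphisms, kernels and cokernels *)

Section Zero.
Variable C : category.

(** The two may factor through different zero objects; [w : z -> z'] reroutes the first through the
    second. *)
Lemma zero_morphism_eq (a b : C) (f g : Hom a b) :
  is_zero_morphism f -> is_zero_morphism g -> f = g.
Proof.
intros [z [u [v [[zi zt] ->]]]] [z' [u' [v' [[zi' zt'] ->]]]].
destruct (zi z') as [w _].
rewrite (@initial_eq C z b v (v' ∘ w) zi), <- comp_assoc.
f_equal; now apply terminal_eq.
Qed.

Lemma zero_morphism_compl (a b c : C) (g : Hom b c) (f : Hom a b) :
  is_zero_morphism f -> is_zero_morphism (g ∘ f).
Proof.
intros [z [u [v [hz ->]]]]; exists z, u, (g ∘ v).
split; [assumption|apply comp_assoc].
Qed.

Lemma zero_morphism_compr (a b c : C) (g : Hom b c) (f : Hom a b) :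
  is_zero_morphism g -> is_zero_morphism (g ∘ f).
Proof.
intros [z [u [v [hz ->]]]]; exists z, (u ∘ f), v.
split; [assumption|symmetry; apply comp_assoc].
Qed.

Lemma zero_morphism_exists (a b : C) :
  pointed C -> exists f : Hom a b, is_zero_morphism f.
Proof.
intros [z [zi zt]]; destruct (zt a) as [u _]; destruct (zi b) as [v _].
now exists (v ∘ u), z, u, v.
Qed.

Lemma zero_morphism_mono (a b c : C) (m : Hom b c) (f : Hom a b) :
  pointed C -> is_mono m -> is_zero_morphism (m ∘ f) -> is_zero_morphism f.
Proof.
intros hC hm hz; destruct (zero_morphism_exists a b hC) as [o ho].
replace f with o; [assumption|].
apply hm, zero_morphism_eq; [now apply zero_morphism_compl|assumption].
Qed.

(** Cancelling [m] makes [a] a retract of the zero object [z]. *)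
Lemma zero_mono_zero_object (a b : C) (m : Hom a b) :
  is_mono m -> is_zero_morphism m -> is_zero_object a.
Proof.
intros hm [z [u [v [[zi zt] e]]]].
destruct (zi a) as [w _].
assert (hwu : w ∘ u = idm a).
{ apply hm; rewrite comp_idr, e, <- comp_assoc.
  f_equal; now apply terminal_eq. }
split; intros x.
- destruct (zi x) as [k _]; exists (k ∘ u); split; [exact I|].
  intros g _; rewrite <- (comp_idr g), <- hwu, comp_assoc.
  f_equal; now apply initial_eq.
- destruct (zt x) as [k _]; exists (w ∘ k); split; [exact I|].
  intros g _; rewrite <- (comp_idl g), <- hwu, <- comp_assoc.
  f_equal; now apply terminal_eq.
Qed.

Lemma cokernel_RegEpi (a b q : C) (f : Hom a b) (p : Hom b q) :
  pointed C -> is_cokernel f p -> RegEpi p.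
Proof.
intros hC [hz hu]; destruct (zero_morphism_exists a b hC) as [o ho].
exists a, f, o; split.
- apply zero_morphism_eq; [assumption|now apply zero_morphism_compl].
- intros x h e; apply hu; rewrite e; now apply zero_morphism_compl.
Qed.

(** If [m] is a kernel of [f], then [f] factors through [p], so [f] kills whatever [p] kills. *)
Lemma kernel_of_cokernel (k b q : C) (m : Hom k b) (p : Hom b q) :
  is_normal_mono m -> is_cokernel m p -> is_kernel p m.
Proof.
intros [_ [d [f [hfm hf]]]] [hpm hp]; split; [assumption|].
intros x h hz; apply hf.
destruct (hp d f hfm) as [f' [<- _]].
rewrite <- comp_assoc; now apply zero_morphism_compl.
Qed.

(** Pulling back preserves kernels; the kernel of [p2] is phrased as a pullback along [z -> b] to
    fit the change of base in [protomodular]. *)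
Lemma kernel_pullback_along_zero (a b c p k z : C) (f : Hom a c) (g : Hom b c)
    (p1 : Hom p a) (p2 : Hom p b) (i : Hom k a) (l : Hom k p)
    (v : Hom z b) (w : Hom k z) :
  is_zero_object z -> is_pullback f g p1 p2 -> is_kernel f i ->
  p1 ∘ l = i -> is_zero_morphism (p2 ∘ l) -> is_pullback p2 v l w.
Proof.
intros hz hp [_ hi] hl hl2.
assert (vz : is_zero_morphism v).
{ exists z, (idm z), v; now rewrite comp_idr. }
split.
- apply zero_morphism_eq; [assumption|now apply zero_morphism_compr].
- intros x u t hut.
  assert (uz : is_zero_morphism (p2 ∘ u)).
  { rewrite hut; now apply zero_morphism_compr. }
  destruct (hi x (p1 ∘ u)) as [h [hh uh]].
  { rewrite comp_assoc, (proj1 hp), <- comp_assoc.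
    now apply zero_morphism_compl. }
  exists h; split; [split|].
  + apply (pullback_eq hp).
    * now rewrite comp_assoc, hl.
    * apply zero_morphism_eq; [|assumption].
      rewrite comp_assoc; now apply zero_morphism_compr.
  + apply terminal_eq, hz.
  + intros h' [hh' _]; apply uh; now rewrite <- hh', comp_assoc, hl.
Qed.

End Zero.

(** * Regular factorizations and extremal epimorphisms *)

Section Regular.
Variable C : category.
Hypothesis hC : regular C.

Lemma regular_factorization (a b : C) (f : Hom a b) :
  exists (q : C) (e : Hom a q) (m : Hom q b),
    RegEpi e /\ is_mono m /\ m ∘ e = f.
Proof.
destruct hC as [[_ hpb] [hcoeq hstab]].
destruct (hpb a a b f f) as [k [p1 [p2 hk]]].
destruct (hcoeq a b k f p1 p2 hk) as [q [e he]].
destruct (proj2 he b f (proj1 hk)) as [m [hm _]].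
assert (re : RegEpi e) by now exists k, p1, p2.
exists q, e, m; repeat split; try assumption.
intros x u v huv.
(* After the regular epimorphisms [e1] and [e2], both [u] and [v] lift along [e]; the lifts agree
   under [f], hence factor through its kernel pair, which [e] coequalizes. *)
destruct (hpb a x q e u) as [x1 [a1 [e1 h1]]].
destruct (hpb a x1 q e (v ∘ e1)) as [x2 [a2 [e2 h2]]].
apply (RegEpi_epi (hstab _ _ _ _ _ _ _ _ h1 re)).
apply (RegEpi_epi (hstab _ _ _ _ _ _ _ _ h2 re)).
destruct h1 as [c1 _], h2 as [c2 _].
rewrite <- c2, <- c1.
destruct (proj2 hk x2 (a1 ∘ e2) a2) as [w [[w1 w2] _]].
{ now rewrite <- hm, <- !comp_assoc, c2, (comp_assoc e a1), c1, !comp_assoc,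
    huv. }
rewrite <- comp_assoc, <- w1, <- w2, !comp_assoc.
now rewrite (proj1 he).
Qed.

Lemma extremal_RegEpi (a b : C) (f : Hom a b) : extremal_epi f -> RegEpi f.
Proof.
intros hf; destruct (regular_factorization f) as [q [e [m [he [hm h]]]]].
destruct (hf q m e hm h) as [r hr].
rewrite <- h; apply (RegEpi_iso_comp he (mono_retraction hm hr) hr).
Qed.

(** Pull the mono [m] back along [g]: [f] factors through the result, which therefore has a section,
    and so [g] factors through [m]. *)
Lemma extremal_epi_comp (a b c : C) (g : Hom b c) (f : Hom a b) :
  extremal_epi g -> extremal_epi f -> extremal_epi (g ∘ f).
Proof.
intros hg hf s m h hm e.
destruct (proj2 (proj1 hC) _ _ _ g m) as [p [p1 [p2 hp]]].
destruct (proj2 hp a f h (eq_sym e)) as [k [[hk _] _]].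
destruct (hf p p1 k (pullback_mono hp hm) hk) as [r hr].
apply (hg s m (p2 ∘ r) hm).
now rewrite comp_assoc, <- (proj1 hp), <- comp_assoc, hr, comp_idr.
Qed.

Lemma RegEpi_comp_iff (a b c : C) (g : Hom b c) (f : Hom a b) :
  RegEpi f -> (RegEpi (g ∘ f) <-> RegEpi g).
Proof.
intros hf; split; intros h; apply extremal_RegEpi.
- now apply extremal_epi_left with a f, RegEpi_extremal.
- now apply extremal_epi_comp; apply RegEpi_extremal.
Qed.

End Regular.

(** * Protomodularity and suprema with a kernel *)

Section Homological.
Variable C : category.
Hypothesis hC : homological C.

(* The change of base is along [q ∘ t] itself: [a ×_c a] and [b ×_c a] are
   points over [a] with sections [(id, id)] and [(t, id)], and both have kernel
   [k], so that [t ×_c a] is invertible. *)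
Lemma subobject_containing_kernel (a b c k : C) (q : Hom b c) (i : Hom k b)
    (t : Hom a b) :
  is_kernel q i -> is_mono t -> sub_le i t -> RegEpi (q ∘ t) ->
  exists r : Hom b a, t ∘ r = idm b.
Proof.
intros hi ht [j hj] hqt.
destruct hC as [hp [hr [_ hm]]].
destruct hp as [z hz].
pose proof (proj2 (proj1 hr)) as hpb.
destruct (hpb _ _ _ (q ∘ t) (q ∘ t)) as [P [p1 [p2 hP]]].
destruct (hpb _ _ _ q (q ∘ t)) as [Q [q1 [q2 hQ]]].
assert (hj' : is_kernel (q ∘ t) j).
{ destruct hi as [hz' hu]; split.
  - now rewrite <- comp_assoc, hj.
  - intros x h hh; destruct (hu x (t ∘ h)) as [w [hw uw]].
    { now rewrite comp_assoc. }
    exists w; split.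
    + apply ht; now rewrite comp_assoc, hj.
    + intros w' <-; apply uw; now rewrite comp_assoc, hj. }
destruct (proj2 hP a (idm a) (idm a) eq_refl) as [s [[s1 s2] _]].
destruct (proj2 hQ a t (idm a)) as [s' [[s1' s2'] _]].
{ now rewrite comp_idr. }
destruct (proj2 hQ P (t ∘ p1) p2) as [phi [[phi1 phi2] _]].
{ now rewrite comp_assoc, (proj1 hP). }
destruct (zero_morphism_exists k a (ex_intro _ z hz)) as [o ho].
destruct (proj2 hP k j o) as [l [[l1 l2] _]].
{ apply zero_morphism_eq; [apply hj'|now apply zero_morphism_compl]. }
destruct (proj1 hz a) as [v _].
destruct (proj2 hz k) as [w _].
assert (hphi : is_iso phi).
(* Protomodularity along [v : z -> a]: both fibres are [k], and [phi] induces the identity between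
   them. *)
{ apply (hm a z v P p2 s Q q2 s' phi k l w k (phi ∘ l) w (idm k));
    try assumption.
  - apply (pullback_eq hQ).
    + now rewrite s1', comp_assoc, phi1, <- comp_assoc, s1, comp_idr.
    + now rewrite s2', comp_assoc, phi2.
  - apply (kernel_pullback_along_zero v w hz hP hj' l1); now rewrite l2.
  - apply (kernel_pullback_along_zero v w hz hQ hi).
    + now rewrite comp_assoc, phi1, <- comp_assoc, l1.
    + now rewrite comp_assoc, phi2, l2.
  - apply comp_idr.
  - apply comp_idr.
  - exists (idm k); now rewrite comp_idl. }
destruct hphi as [psi [_ hpsi]].
assert (hq1 : RegEpi q1).
{ apply (proj2 (proj2 hr) _ _ _ _ _ _ _ _ (pullback_sym hQ) hqt). }
(* Since [t ∘ p1 = q1 ∘ phi], the regular epimorphism [q1] factors through the mono [t]. *)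
apply (RegEpi_extremal hq1 ht (h := p1 ∘ psi)).
now rewrite comp_assoc, <- phi1, <- comp_assoc, hpsi, comp_idr.
Qed.

Lemma sup_with_kernel_whole (h b c k : C) (q : Hom b c) (i : Hom k b)
    (m : Hom h b) :
  RegEpi q -> is_kernel q i ->
  (RegEpi (q ∘ m) <-> sup_is_whole m i).
Proof.
intros hq hi; pose proof (proj1 (proj2 hC)) as hr; split.
- intros hqm; split; [|split; [|split]].
  + intros x u v; now rewrite !comp_idl.
  + exists m; apply comp_idl.
  + exists i; apply comp_idl.
  + intros s t ht [m' hm'] hit.
    apply (subobject_containing_kernel hi ht hit).
    apply (extremal_RegEpi hr), (extremal_epi_left (f := m')).
    rewrite <- comp_assoc, hm'; now apply RegEpi_extremal.
- intros [_ [_ [_ hs]]]; apply (extremal_RegEpi hr).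
  intros s n e hn hne.
  destruct (proj2 (proj1 hr) _ _ _ q n) as [p [p1 [p2 hp]]].
  destruct (hs p p1 (pullback_mono hp hn)) as [r hpr].
  + destruct (proj2 hp h m e (eq_sym hne)) as [w [[hw _] _]]; now exists w.
  (* As [q ∘ i] and [n ∘ o] are both zero, [i] and [o] induce a map into the pullback. *)
  + destruct (zero_morphism_exists k s (proj1 hC)) as [o ho].
    destruct (proj2 hp k i o) as [w [[hw _] _]]; [|now exists w].
    apply zero_morphism_eq; [apply hi|now apply zero_morphism_compl].
  + apply (RegEpi_extremal hq hn (h := p2 ∘ r)).
    now rewrite comp_assoc, <- (proj1 hp), <- comp_assoc, hpr, comp_idr.
Qed.

End Homological.

(** * Objects with zero radical and their regular epimorphisms *)

Section Radical.
Variables (C : category) (R : radical C).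
Hypothesis hC : homological C.

(** Naturality of [mu] factors the composite through [R x]. *)
Lemma mu_radical_free (a x : C) (f : Hom a x) :
  is_zero_object (R x) -> is_zero_morphism (f ∘ mu R a).
Proof.
intros hx.
pose proof (naturality (mu R) f) as e; cbn in e; rewrite <- e.
now exists (R x), (fmap R f), (mu R x).
Qed.

Lemma radical_free_of_zero_mu (a : C) :
  is_zero_morphism (mu R a) -> is_zero_object (R a).
Proof. apply zero_mono_zero_object, mu_normal. Qed.

Lemma radical_free_subobject (a x : C) (m : Hom a x) :
  is_mono m -> is_zero_object (R x) -> is_zero_object (R a).
Proof.
intros hm hx; apply radical_free_of_zero_mu.
apply (zero_morphism_mono (proj1 hC) hm), (mu_radical_free m hx).
Qed.

(** The projections are jointly monic and both kill [mu R k]. *)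
Lemma radical_free_kernel_pair (x y k : C) (f : Hom x y) (p1 p2 : Hom k x) :
  is_kernel_pair f p1 p2 -> is_zero_object (R x) -> is_zero_object (R k).
Proof.
intros hk hx; apply radical_free_of_zero_mu.
destruct (zero_morphism_exists (R k) k (proj1 hC)) as [o ho].
replace (component (mu R) k) with o; [assumption|].
apply (pullback_eq hk); apply zero_morphism_eq;
  (now apply zero_morphism_compl) || now apply mu_radical_free.
Qed.

Lemma radical_free_RegEpi (x y : radical_free R) (g : Hom x y) :
  RegEpi g <-> RegEpi (C := C) (g : @Hom C (proj1_sig x) (proj1_sig y)).
Proof.
destruct x as [x hx], y as [y hy]; cbn in g |- *.
pose proof (proj1 (proj2 hC)) as hr; split.
- intros hg; apply (extremal_RegEpi hr); intros s m h hm e.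
  pose (s' := exist _ s (radical_free_subobject hm hy) : radical_free R).
  refine (RegEpi_extremal hg (s := s') (m := m) (h := h) _ e).
  intros w u v; apply hm.
- intros hg.
  destruct (proj2 (proj1 hr) _ _ _ g g) as [k [p1 [p2 hk]]].
  pose (k' := exist _ k (radical_free_kernel_pair hk hx) : radical_free R).
  exists k', p1, p2; split; [apply hk|].
  intros [w hw] h e; cbn in h, e |- *.
  (* The pair [u], [v] lives in [C], perhaps outside the subcategory; it factors through the kernel
     pair of [g], so [h] coequalizes it too. *)
  destruct hg as [l [u [v [hc hu]]]].
  apply hu.
  destruct (proj2 hk l u v hc) as [d [[<- <-] _]].
  now rewrite !comp_assoc, e.
Qed.

End Radical.

Theorem proposition4p2 (C : category) (hC : homological C)
    (R : radical C) (I : radical_reflection R) :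
  (forall (c c' : C) (f : Hom c c'),
     inverse_image_class I (RegEpi (C:=radical_free R)) f
     <-> RegEpi (eta I c' ∘ f)) /\
  (forall (c c' : C) (f : Hom c c') (im : C) (m : Hom im c'),
     is_image f m -> is_normal_mono m ->
     (inverse_image_class I (RegEpi (C:=radical_free R)) f
      <-> sup_is_whole m (mu R c'))) /\
  (abelian C ->
   forall (c c' : C) (f : Hom c c') (im : C) (m : Hom im c'),
     is_image f m ->
     (inverse_image_class I (RegEpi (C:=radical_free R)) f
      <-> sup_is_whole m (mu R c'))).
Proof.
pose proof (proj1 (proj2 hC)) as hr.
assert (heta : forall c : C, RegEpi (eta I c)).
{ intros c; apply (cokernel_RegEpi (proj1 hC) (eta_cokernel I c)). }
assert (hI : forall (c c' : C) (f : Hom c c'),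
  inverse_image_class I (RegEpi (C:=radical_free R)) f
  <-> RegEpi (eta I c' ∘ f)).
{ intros c c' f; unfold inverse_image_class.
  rewrite (radical_free_RegEpi hC).
  rewrite (naturality (eta I) f : eta I c' ∘ f = _).
  symmetry; apply (RegEpi_comp_iff hr), heta. }
assert (him : forall (c c' : C) (f : Hom c c') (im : C) (m : Hom im c'),
  is_image f m ->
  (inverse_image_class I (RegEpi (C:=radical_free R)) f
   <-> sup_is_whole m (mu R c'))).
{ intros c c' f im m [_ [e [he ->]]].
  (* The factor [e] of [f] is cancelled, leaving a condition on [eta I c' ∘ m] alone. *)
  rewrite hI, comp_assoc, (RegEpi_comp_iff hr _ he).
  apply (sup_with_kernel_whole hC _ (heta c')).
  apply kernel_of_cokernel; [apply mu_normal|apply eta_cokernel]. }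
split; [exact hI|split].
- intros c c' f im m hm _; now apply him.
- intros _; exact him.
Qed.
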